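(* Let $G$ be an $r$-regular ($r\geq2$) connected graph of order $n$ with $m$ edges, with distinct adjacency eigenvalues $r=\lambda_0>\lambda_1>\cdots>\lambda_d$ and eigenprojectors $E_{\lambda_i}$. Let $R_G$ be the $n\times m$ vertex-edge incidence matrix of $G$, and $\lambda_{i\pm}=\frac{r+\lambda_i-2\pm\sqrt{(\lambda_i+r)^2+4}}{2}$. (a) If $G$ is non-bipartite, let $\zeta_1,\ldots,\zeta_{m-n}$ be all unit orthogonal vectors with $R_G\zeta_k=0$. Then the eigenprojectors of $A(\mathcal{Q}(G))$ for $\lambda_{i\pm}$ ($i\in[d]\cup\{0\}$) and $-2$ are $$F_{\lambda_{i\pm}}=\frac{1}{(\lambda_{i\pm}+2-r-\lambda_i)^2+\lambda_i+r}\begin{pmatrix}(\lambda_{i\pm}+2-r-\lambda_i)^2E_{\lambda_i} & (\lambda_{i\pm}+2-r-\lambda_i)E_{\lambda_i}R_G\\ (\lambda_{i\pm}+2-r-\lambda_i)(E_{\lambda_i}R_G)^T & R_G^TE_{\lambda_i}R_G\end{pmatrix},$$ $$F_{-2}=\sum_{k=1}^{m-n}\frac{1}{\|\zeta_k\|^2}\begin{pmatrix}0&0\\0&\zeta_k\zeta_k^T\end{pmatrix},$$ and $A(\mathcal{Q}(G))=\sum_{i=0}^d\sum_\pm\lambda_{i\pm}F_{\lambda_{i\pm}}+(-2)F_{-2}$. (b) If $G$ is bipartite (so $\lambda_d=-r$), with bipartition $V_1\cup V_2$, let $\zeta_1,\ldots,\zeta_{m-n+1}$ be all unit orthogonal vectors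 with $R_G\zeta_k=0$. Then the eigenprojectors of $A(\mathcal{Q}(G))$ for $-2$, $0$ and $\lambda_{i\pm}$ ($i\in[d-1]\cup\{0\}$) are $$F_{-2}=\sum_{k=1}^{m-n+1}\frac{1}{\|\zeta_k\|^2}\begin{pmatrix}0&0\\0&\zeta_k\zeta_k^T\end{pmatrix},\qquad F_0=\frac1n\begin{pmatrix}J_{n/2}&-J_{n/2}&0\\-J_{n/2}&J_{n/2}&0\\0&0&0\end{pmatrix}=\begin{pmatrix}E_{-r}&0\\0&0\end{pmatrix},$$ and $F_{\lambda_{i\pm}}$ given by the same formula as in (a) for $i\neq d$; and $A(\mathcal{Q}(G))=\sum_{i=0}^{d-1}\sum_\pm\lambda_{i\pm}F_{\lambda_{i\pm}}+(-2)F_{-2}+0F_0$.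
   Context: $\mathcal{Q}(G)$ is obtained from $G$ by inserting a new vertex on each edge of $G$ and joining two new vertices by an edge whenever the corresponding edges of $G$ are adjacent; $A(\mathcal{Q}(G))=\begin{pmatrix}O & R_G\\ R_G^T & R_G^TR_G-2I_m\end{pmatrix}$ with the vertices of $G$ listed first (in the bipartite case, $V_1$ before $V_2$). The eigenprojector of $A(G)$ for $\lambda_i$ is $E_{\lambda_i}=\sum_{j=1}^{a_i}x_j^{(i)}(x_j^{(i)})^T$ for an orthonormal eigenbasis $x_1^{(i)},\ldots,x_{a_i}^{(i)}$ of that eigenspace. $J_k$ denotes the $k\times k$ all-one matrix, $[n]=\{1,\ldots,n\}$. *)

(* Defs.v *)
From HB Require Import structures.
From mathcomp Require Import all_boot all_order all_algebra.

Set Implicit Arguments.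
Unset Strict Implicit.
Unset Printing Implicit Defensive.

Import Order.TTheory GRing.Theory Num.Theory.
Local Open Scope ring_scope.

Record sgraph (V : finType) := SGraph {
  adj :> rel V;
  adj_sym : symmetric adj;
  adj_irr : irreflexive adj
}.

Definition edges (V : finType) (G : sgraph V) : {set {set V}} :=
  [set S | [exists x, exists y, G x y && (S == [set x; y])]].

Definition edge (V : finType) (G : sgraph V) : finType :=
  {S : {set V} | S \in edges G}.

Definition ends (V : finType) (G : sgraph V) (e : edge G) : {set V} := sval e.

Definition regular (V : finType) (G : sgraph V) (r : nat) : Prop :=
  forall x, #|[set y | G x y]| = r.

Definition connected (V : finType) (G : sgraph V) : Prop :=
  (0 < #|V|)%N /\ forall x y, connect G x y.

Definition bipartition (V : finType) (G : sgraph V) (V1 V2 : {set V}) : Prop :=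
  [/\ V1 :|: V2 = [set: V], [disjoint V1 & V2]
    & forall x y, G x y ->
        (x \in V1) && (y \in V2) || (x \in V2) && (y \in V1)].

Definition bipartite (V : finType) (G : sgraph V) : Prop :=
  exists V1 V2 : {set V}, bipartition G V1 V2.

(* The graph Q(G): each edge of G is subdivided by a new vertex (so the edge
   itself disappears), and new vertices of distinct edges of G that share an
   end are joined. *)
Definition Qadj (V : finType) (G : sgraph V) (a b : V + edge G) : bool :=
  match a, b with
  | inl _, inl _ => false
  | inl x, inr e | inr e, inl x => x \in ends e
  | inr e, inr e' => (e != e') && (ends e :&: ends e' != set0)
  end.

Lemma Qadj_sym (V : finType) (G : sgraph V) : symmetric (@Qadj V G).
Proof. by move=> [x|e] [y|e'] //=; rewrite eq_sym setIC. Qed.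

Lemma Qadj_irr (V : finType) (G : sgraph V) : irreflexive (@Qadj V G).
Proof. by move=> [x|e] //=; rewrite eqxx. Qed.

Definition Qgraph (V : finType) (G : sgraph V) : sgraph (V + edge G)%type :=
  SGraph (@Qadj_sym V G) (@Qadj_irr V G).

(* Matrices are taken along an enumeration v of the vertices and f of the
   edges; both are required to be bijective where they are used. *)
Definition adjmx (R : rcfType) (V : finType) (G : sgraph V) (n : nat)
    (v : 'I_n -> V) : 'M[R]_n :=
  \matrix_(i, j) (G (v i) (v j))%:R.

Definition incmx (R : rcfType) (V : finType) (G : sgraph V) (n m : nat)
    (v : 'I_n -> V) (f : 'I_m -> edge G) : 'M[R]_(n, m) :=
  \matrix_(i, j) (v i \in ends (f j))%:R.

(* Vertices of Q(G) enumerated with the vertices of G first. *)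
Definition Qenum (V : finType) (G : sgraph V) (n m : nat)
    (v : 'I_n -> V) (f : 'I_m -> edge G) (k : 'I_(n + m)) : V + edge G :=
  match split k with
  | inl i => inl (v i)
  | inr j => inr (f j)
  end.

Definition sqnorm (R : rcfType) (n : nat) (x : 'cV[R]_n) : R :=
  (x^T *m x) 0 0.

Definition orthonormal_family (R : rcfType) (n k : nat)
    (x : 'I_k -> 'cV[R]_n) : Prop :=
  forall i j, ((x i)^T *m x j) 0 0 = (i == j)%:R.

(* MathComp's eigenspace consists of row vectors u with u *m A = a *: u, whence
   the transpose.  If a is not an eigenvalue, then k = 0 and E = 0. *)
Definition eigenprojector (R : rcfType) (n : nat) (A : 'M[R]_n) (a : R)
    (E : 'M[R]_n) : Prop :=
  exists (k : nat) (x : 'I_k -> 'cV[R]_n),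
    [/\ orthonormal_family x,
        (\matrix_(j < k) (x j)^T == eigenspace A^T a)%MS
      & E = \sum_(j < k) x j *m (x j)^T].

(* The numbers lambda_{i+} (s = false) and lambda_{i-} (s = true), where
   l = lambda_i. *)
Definition lamQ (R : rcfType) (r : nat) (l : R) (s : bool) : R :=
  (r%:R + l - 2 + (-1) ^+ s * Num.sqrt ((l + r%:R) ^+ 2 + 4)) / 2.

(* F_{lambda_{i+}} and F_{lambda_{i-}}, where E = E_{lambda_i}. *)
Definition FQ (R : rcfType) (n m r : nat) (RG : 'M[R]_(n, m)) (l : R)
    (E : 'M[R]_n) (s : bool) : 'M[R]_(n + m) :=
  let c := lamQ r l s + 2 - r%:R - l in
  (c ^+ 2 + l + r%:R)^-1 *:
    block_mx (c ^+ 2 *: E)           (c *: (E *m RG))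
             (c *: (E *m RG)^T)      (RG^T *m E *m RG).

Definition FQ_m2 (R : rcfType) (n m q : nat) (zeta : 'I_q -> 'cV[R]_m) :
    'M[R]_(n + m) :=
  \sum_(k < q) (sqnorm (zeta k))^-1 *:
    block_mx 0 0 0 (zeta k *m (zeta k)^T).

(* F_0 in the bipartite case; hn lets the blocks of size n/2 tile an n x n
   matrix. *)
Definition FQ_0 (R : rcfType) (n m : nat) (hn : (n./2 + n./2)%N = n) :
    'M[R]_(n + m) :=
  let J : 'M[R]_(n./2) := const_mx 1 in
  n%:R^-1 *: block_mx (castmx (hn, hn) (block_mx J (- J) (- J) J)) 0 0 0.

Lemma card_ends (V : finType) (G : sgraph V) (e : edge G) : #|ends e| = 2.
Proof.
case: e => S; rewrite /ends /= inE => /existsP [x /existsP [y /andP [xy /eqP ->]]].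
by rewrite cards2; case: eqVneq xy => // ->; rewrite adj_irr.
Qed.

Lemma ends_inj (V : finType) (G : sgraph V) : injective (@ends V G).
Proof. exact: val_inj. Qed.

Lemma adjmx_Qgraph (R : rcfType) (V : finType) (G : sgraph V) (n m : nat)
    (v : 'I_n -> V) (f : 'I_m -> edge G) :
  bijective v -> injective f ->
  let RG := incmx R v f in
  adjmx R (Qgraph G) (Qenum v f) = block_mx 0 RG RG^T (RG^T *m RG - 2%:M).
Proof.
move=> bij_v inj_f RG; apply/matrixP => i j.
rewrite /block_mx !mxE /Qenum.
case: (split i) => a; rewrite ?mxE; case: (split j) => b; rewrite !mxE //=.
have -> : \sum_k RG^T a k * RG k b = #|ends (f a) :&: ends (f b)|%:R.
  rewrite -sum1_card natr_sum [RHS]big_mkcond /=.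
  rewrite (reindex v) /=; last exact: onW_bij.
  apply: eq_bigr => k _; rewrite !mxE inE.
  by case: (_ \in _); case: (_ \in _); rewrite ?mul1r ?mul0r.
case: (eqVneq a b) => [-> | ab].
  by rewrite eqxx setIid card_ends mulr1n subrr.
have fab : f a != f b by apply: contra_neq ab => /inj_f.
rewrite fab mulr0n subr0 /= -card_gt0.
suff : (#|ends (f a) :&: ends (f b)| < 2)%N by case: #|_| => [|[|]].
rewrite ltnNge; apply: contra fab => le2.
apply/eqP/ends_inj; transitivity (ends (f a) :&: ends (f b)).
  by apply/esym/eqP; rewrite eqEcard subsetIl card_ends.
by apply/eqP; rewrite eqEcard subsetIr card_ends.
Qed.

(* Main.v *)
Require Import Defs.
From HB Require Import structures.
From mathcomp Require Import all_boot all_order all_algebra.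
From mathcomp Require Import complex ring lra zify.

Set Implicit Arguments.
Unset Strict Implicit.
Unset Printing Implicit Defensive.

Import Order.TTheory GRing.Theory Num.Theory.
Local Open Scope ring_scope.

(* Write A for the adjacency matrix of G and B for its incidence matrix, so that
   B B^T = A + r.  If A u = l u and t = l + r > 0, the column (c u, B^T u) is an
   eigenvector of A(Q(G)) for x as soon as x c = t and x = c - 2 + t, that is for
   x = lambda_{i+-} and c = x + 2 - t, and its squared norm is (c^2 + t) |u|^2.
   The columns (0, zeta_k) are eigenvectors for -2, and (u, 0) is one for 0 when
   t = 0.  The candidate projectors built from these families sum to 1: on the
   vertex block this is the spectral theorem for A, and on the edge block a
   symmetric idempotent of order m has trace m.  A resolution of the identity into
   eigenvectors for distinct numbers leaves no room for other eigenvectors, which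
   gives the spectrum, the eigenprojectors and the decomposition at once.  A
   vector u has t = 0 exactly when B^T u = 0, i.e. when u changes sign along every
   edge; in a connected graph such a nonzero u exists only in the bipartite case
   and is then unique up to a factor. *)

(** * Symmetric matrices and their eigenprojectors *)

Lemma mxtrace_mul_tr_ge0 (R : realDomainType) (p q : nat) (M : 'M[R]_(p, q)) :
  0 <= \tr (M *m M^T).
Proof.
apply: sumr_ge0 => i _; rewrite mxE; apply: sumr_ge0 => j _.
by rewrite mxE -expr2 sqr_ge0.
Qed.

Lemma mxtrace_mul_tr_eq0 (R : realDomainType) (p q : nat) (M : 'M[R]_(p, q)) :
  \tr (M *m M^T) = 0 -> M = 0.
Proof.
have sq i j : 0 <= M i j * M^T j i by rewrite mxE -expr2 sqr_ge0.
rewrite /mxtrace; under eq_bigr do rewrite mxE.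
move/eqP; rewrite psumr_eq0 => [/allP M0|i _]; last exact: sumr_ge0.
apply/matrixP => i j; rewrite mxE; apply/eqP.
have := M0 i (mem_index_enum _).
rewrite psumr_eq0 // => /allP/(_ j (mem_index_enum _)).
by rewrite mxE -expr2 sqrf_eq0.
Qed.

(** With [w] the conjugate of [u], evaluating u B w^T from both sides gives z |u|^2 = conj(z) |u|^2,
    where |u|^2 is nonzero. *)
Lemma eigenvalue_sym_real (R : rcfType) (n : nat) (A : 'M[R]_n) (z : R[i]) :
  A^T = A -> eigenvalue (map_mx (real_complex R) A) z ->
  exists x : R, z = (x%:C)%C.
Proof.
move=> symA /eigenvalueP [u uA u0]; apply/complex_realP.
set B := map_mx _ A in uA.
set w := map_mx Num.conj u.
have Bw : B *m w^T = z^* *: w^T.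
  have trB : B^T = B by rewrite /B map_trmx symA.
  have cB : map_mx Num.conj B = B.
    apply/matrixP => i j; rewrite !mxE; apply/eqP.
    by rewrite -CrealE; apply/complex_realP; exists (A i j).
  rewrite -{1}trB -trmx_mul -{1}cB -map_mxM uA.
  by rewrite map_mxZ linearZ.
have : z *: (u *m w^T) = z^* *: (u *m w^T).
  by rewrite scalemxAl -uA -mulmxA Bw -scalemxAr.
move/matrixP/(_ 0 0); rewrite !mxE => /mulIf E; rewrite CrealE eq_sym.
apply/eqP/E; apply: contraNneq u0 => s0.
have /eqP := s0; under eq_bigr do rewrite !mxE -normCK.
rewrite psumr_eq0 => [/allP u0|i _]; last exact: exprn_ge0.
apply/eqP/rowP => j; rewrite mxE; apply/eqP.
by have := u0 j (mem_index_enum _); rewrite sqrf_eq0 normr_eq0.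
Qed.

(** Over R[i] the characteristic polynomial splits and its roots are eigenvalues, hence real; the
    factorization descends because extension of coefficients is injective. *)
Lemma char_poly_sym_split (R : rcfType) (n : nat) (A : 'M[R]_n) :
  A^T = A -> exists s : seq R, char_poly A = \prod_(x <- s) ('X - x%:P).
Proof.
move=> symA.
have [s] := closed_field_poly_normal (char_poly (map_mx (real_complex R) A)).
rewrite (eqP (char_poly_monic _)) scale1r => sE.
have sR z : z \in s -> exists x : R, z = (x%:C)%C.
  move=> zs; apply: (eigenvalue_sym_real symA).
  by rewrite eigenvalue_root_char sE root_prod_XsubC.
have {sR} [t st] : exists t : seq R, s = map (real_complex R) t.
  elim: s sR {sE} => [|z s IHs] sR; first by exists [::].
  have [x xz] := sR z (mem_head _ _).
  have [|t ->] := IHs; first by move=> y ys; apply: sR; rewrite inE ys orbT.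
  by exists (x :: t); rewrite xz.
exists t; apply: (map_poly_inj (real_complex R)).
rewrite map_char_poly sE st big_map rmorph_prod /=.
by apply: eq_bigr => x _; rewrite rmorphB /= map_polyX map_polyC.
Qed.

(* By Cayley-Hamilton some product of factors [A - x] vanishes, while by
   assumption no single factor kills a nonzero vector fixed by [Q]. *)
Lemma sym_stable_eq0 (R : rcfType) (n : nat) (A Q : 'M[R]_n) :
  A^T = A -> Q *m Q = Q -> Q *m A = A *m Q ->
  (forall (x : R) (u : 'rV_n), u *m A = x *: u -> u *m Q = 0) -> Q = 0.
Proof.
case: n A Q => [|n] A Q symA QQ QA Q0; first exact: flatmx0.
have [s sE] := char_poly_sym_split symA.
have := Cayley_Hamilton A; rewrite sE rmorph_prod /=.
under eq_bigr do rewrite rmorphB /= horner_mx_X horner_mx_C.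
clear sE; suff H (s' : seq R) (u : 'rV_n.+1) : u *m Q = u ->
    u *m (\prod_(x <- s') (A - x%:M)) = 0 -> u = 0.
  move=> P0; apply/row_matrixP => i; rewrite row0.
  apply: (H s); last by rewrite P0 mulmx0.
  by rewrite -row_mul QQ.
elim: s' u => [|x s' IHs] u uQ; first by rewrite big_nil mulmx1.
rewrite big_cons mulmxA => /IHs uA.
have : u *m (A - x%:M) = 0.
  apply: uA; rewrite mulmxBr mulmxBl -mulmxA -QA mulmxA uQ.
  by rewrite mul_mx_scalar -scalemxAl uQ.
rewrite mulmxBr mul_mx_scalar => /eqP; rewrite subr_eq0 => /eqP /Q0.
by rewrite uQ.
Qed.

Lemma tr_sum_outer (R : comPzRingType) (n k : nat) (x : 'I_k -> 'cV[R]_n) :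
  (\sum_j x j *m (x j)^T)^T = \sum_j x j *m (x j)^T.
Proof. by rewrite linear_sum; apply: eq_bigr => j _; rewrite /= trmx_mul trmxK. Qed.

Lemma trmx_adjmx (R : rcfType) (V : finType) (G : sgraph V) (n : nat)
    (v : 'I_n -> V) : (adjmx R G v)^T = adjmx R G v.
Proof. by apply/matrixP => i j; rewrite !mxE adj_sym. Qed.

Section Eigenprojector.
Variables (R : rcfType) (n : nat) (A : 'M[R]_n).
Hypothesis symA : A^T = A.

Lemma orthonormal_mul (k : nat) (x : 'I_k -> 'cV[R]_n) i j :
  orthonormal_family x -> (x i)^T *m x j = (i == j)%:R%:M.
Proof. by move=> ox; rewrite [LHS]mx11_scalar ox. Qed.

Lemma orthonormal_sum (k : nat) (x : 'I_k -> 'cV[R]_n) i :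
  orthonormal_family x -> (x i)^T *m (\sum_j x j *m (x j)^T) = (x i)^T.
Proof.
move=> ox; rewrite mulmx_sumr (bigD1 i) //= mulmxA orthonormal_mul // eqxx mul1mx.
rewrite big1 ?addr0 // => j ji.
by rewrite mulmxA orthonormal_mul // eq_sym (negbTE ji) raddf0 mul0mx.
Qed.

Lemma orthonormal_idem (k : nat) (x : 'I_k -> 'cV[R]_n) :
  orthonormal_family x ->
  let P := \sum_j x j *m (x j)^T in P *m P = P.
Proof.
move=> ox P; rewrite {1}/P mulmx_suml; apply: eq_bigr => j _.
by rewrite -mulmxA orthonormal_sum.
Qed.

Lemma orthonormal_trace (k : nat) (x : 'I_k -> 'cV[R]_n) :
  orthonormal_family x -> \tr (\sum_j x j *m (x j)^T) = k%:R.
Proof.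
move=> ox; rewrite linear_sum /= (eq_bigr (fun=> 1)) ?sumr_const ?card_ord //.
by move=> j _; rewrite mxtrace_mulC orthonormal_mul // eqxx mxtrace_scalar.
Qed.

(** Completeness of the family is asked in terms of its projector, the form in which a resolution of
    the identity delivers it. *)
Lemma eigenprojectorI (a : R) (k : nat) (x : 'I_k -> 'cV[R]_n) :
  orthonormal_family x -> (forall j, A *m x j = a *: x j) ->
  (forall u : 'rV_n, u *m A = a *: u -> u *m (\sum_j x j *m (x j)^T) = u) ->
  eigenprojector A a (\sum_j x j *m (x j)^T).
Proof.
move=> ox Ax Px; exists k, x; split=> //; apply/andP; split.
  apply/eigenspaceP/row_matrixP => j; rewrite row_mul rowK linearZ /= rowK.
  by rewrite -trmx_mul Ax linearZ.
apply/row_subP => i; have /eigenspaceP := row_sub i (eigenspace A^T a).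
rewrite symA => /Px <-; rewrite mulmx_sumr; apply: summx_sub => j _.
rewrite mulmxA; apply: submx_trans (submxMl _ _) _.
by rewrite -[X in (X <= _)%MS](rowK (fun j => (x j)^T)) row_sub.
Qed.

Variables (a : R) (E : 'M[R]_n).
Hypothesis EP : eigenprojector A a E.

Lemma eigenprojector_tr : E^T = E.
Proof. by have [k [x [_ _ ->]]] := EP; rewrite tr_sum_outer. Qed.

Lemma eigenprojector_idem : E *m E = E.
Proof. by have [k [x [ox _ ->]]] := EP; apply: orthonormal_idem. Qed.

Lemma eigenprojector_mull : E *m A = a *: E.
Proof.
have [k [x [ox /andP [/eigenspaceP xA _] ->]]] := EP.
rewrite mulmx_suml scaler_sumr; apply: eq_bigr => j _.
rewrite -mulmxA scalemxAr; congr (_ *m _).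
by have /(congr1 (row j)) := xA; rewrite row_mul linearZ /= rowK symA.
Qed.

Lemma eigenprojector_mulr : A *m E = a *: E.
Proof.
rewrite -{1}symA -{1}eigenprojector_tr -trmx_mul eigenprojector_mull.
by rewrite linearZ /= eigenprojector_tr.
Qed.

Lemma eigenprojector_fix (u : 'rV_n) : u *m A = a *: u -> u *m E = u.
Proof.
have [k [x [ox /andP [_ xA] EE]]] := EP => uA.
have /submxP [D ->] : (u <= \matrix_(j < k) (x j)^T)%MS.
  by apply: submx_trans xA; apply/eigenspaceP; rewrite symA.
rewrite -mulmxA; congr (_ *m _); apply/row_matrixP => j.
by rewrite row_mul rowK EE orthonormal_sum.
Qed.

End Eigenprojector.

(** M A N is evaluated from both sides. The free sizes of [M] and [N] cover vectors and projectors
    alike. *)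
Lemma eigenvector_orth (R : fieldType) (n p q : nat) (A : 'M[R]_n) (a b : R)
    (M : 'M[R]_(p, n)) (N : 'M[R]_(n, q)) :
  a != b -> M *m A = a *: M -> A *m N = b *: N -> M *m N = 0.
Proof.
move=> ab MA AN; have : (a - b) *: (M *m N) = 0.
  by rewrite scalerBl scalemxAl -MA scalemxAr -AN mulmxA subrr.
by move/eqP; rewrite scaler_eq0 subr_eq0 (negbTE ab) => /eqP.
Qed.

(** Spectral theorem: the complement of the sum is an idempotent that commutes with [A] and kills
    every eigenvector, so [sym_stable_eq0] applies. *)
Lemma sum_eigenprojectors (R : rcfType) (n : nat) (A : 'M[R]_n) (I : finType)
    (lam : I -> R) (E : I -> 'M[R]_n) :
  A^T = A -> injective lam ->
  (forall a, eigenvalue A a -> exists i, a = lam i) ->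
  (forall i, eigenprojector A (lam i) (E i)) -> \sum_i E i = 1%:M.
Proof.
move=> symA lamI lamP EP; set P := \sum_i E i.
have orthE i j : i != j -> E i *m E j = 0.
  move=> ij; apply: (@eigenvector_orth _ _ _ _ A (lam i) (lam j)).
  - by rewrite (inj_eq lamI).
  - exact: eigenprojector_mull (EP i).
  - exact: eigenprojector_mulr (EP j).
have PP : P *m P = P.
  rewrite /P mulmx_suml; apply: eq_bigr => i _.
  rewrite mulmx_sumr (bigD1 i) //= (eigenprojector_idem (EP i)).
  by rewrite big1 ?addr0 // => j ji; rewrite orthE // eq_sym.
have PA : P *m A = A *m P.
  rewrite /P mulmx_suml mulmx_sumr; apply: eq_bigr => i _.
  by rewrite (eigenprojector_mull symA (EP i)) (eigenprojector_mulr symA (EP i)).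
suff : 1%:M - P = 0 by move/eqP; rewrite subr_eq0 => /eqP <-.
apply: (sym_stable_eq0 symA).
- by rewrite mulmxBl mul1mx mulmxBr mulmx1 PP subrr subr0.
- by rewrite mulmxBl mulmxBr PA mul1mx mulmx1.
move=> x u uA; apply/eqP; rewrite mulmxBr mulmx1 subr_eq0; apply/eqP.
have [->|u0] := eqVneq u 0; first by rewrite mul0mx.
have [i xi] := lamP x (introT eigenvalueP (ex_intro2 _ _ u uA u0)).
rewrite mulmx_sumr (bigD1 i) //= (eigenprojector_fix symA (EP i)) -?xi //.
rewrite big1 ?addr0 // => j ji.
apply: (@eigenvector_orth _ _ _ _ A x (lam j)) => //.
  by rewrite xi (inj_eq lamI) eq_sym.
exact: eigenprojector_mulr (EP j).
Qed.

(** * Incidence matrix of a regular graph *)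

Lemma mem_edges (V : finType) (G : sgraph V) (x y : V) :
  G x y -> [set x; y] \in edges G.
Proof.
move=> xy; rewrite inE; apply/existsP; exists x; apply/existsP; exists y.
by rewrite xy eqxx.
Qed.

Lemma card_edge (V : finType) (G : sgraph V) (P : pred {set V}) :
  #|[set e : edge G | P (ends e)]| = #|[set S in edges G | P S]|.
Proof.
rewrite -(card_imset _ (@ends_inj V G)); apply: eq_card => S.
apply/imsetP/idP => [[e] |]; rewrite !inE.
  by move=> Pe ->; rewrite Pe andbT; move: (valP e); rewrite inE.
move=> /andP [eS PS].
have eS' : S \in edges G by rewrite inE.
by exists (exist _ S eS' : edge G); rewrite ?inE.
Qed.

(** The map y -> {x, y} is a bijection from the neighbours of x to the edges at x. *)
Lemma card_incident (V : finType) (G : sgraph V) (x : V) :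
  #|[set S in edges G | x \in S]| = #|[set y | G x y]|.
Proof.
have inj : {in [set y | G x y] &, injective (fun y => [set x; y])}.
  move=> y z; rewrite !inE => xy xz /setP/(_ y); rewrite !inE eqxx orbT.
  by case: eqVneq xy => [->|_ _ /esym/eqP //]; rewrite adj_irr.
rewrite -(card_in_imset inj); apply: eq_card => S.
apply/idP/imsetP => [|[y]]; last first.
  by rewrite inE => xy ->; rewrite inE mem_edges //= set21.
rewrite !inE => /andP [/existsP [a /existsP [b /andP [ab /eqP ->]]]].
rewrite !inE => /orP [] /eqP xE; first by exists b; rewrite ?inE xE.
by exists a; rewrite ?inE xE 1?adj_sym // setUC.
Qed.

Lemma card_joining (V : finType) (G : sgraph V) (x y : V) : x != y ->
  #|[set S in edges G | (x \in S) && (y \in S)]| = G x y.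
Proof.
(* The right side becomes [G x y] times the size of the singleton of {x, y}, the only edge that can
   contain both points. *)
move=> xy; rewrite -[RHS]muln1 -(cards1 [set x; y]) -[RHS]/(_ * _)%N.
have ES S : S \in edges G -> x \in S -> y \in S -> S = [set x; y] /\ G x y.
  rewrite inE => /existsP [a /existsP [b /andP [ab /eqP ->]]]; rewrite !inE.
  move=> /orP [] /eqP xE /orP [] /eqP yE; move: xy; rewrite xE yE ?eqxx // => _.
  by rewrite setUC adj_sym.
case Gxy: (G x y); last first.
  apply/eqP; rewrite mul0n cards_eq0; apply/eqP/setP => S; rewrite [in RHS]inE.
  apply/negbTE/negP; rewrite inE => /andP [eS /andP [xS yS]].
  by have [_] := ES S eS xS yS; rewrite Gxy.
rewrite mul1n; apply: eq_card => S; rewrite [RHS]inE.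
apply/idP/eqP => [|->].
  by rewrite inE => /andP [eS /andP [xS yS]]; case: (ES S eS xS yS).
by rewrite inE mem_edges // set21 set22.
Qed.

Section Incidence.
Variables (R : rcfType) (V : finType) (G : sgraph V) (n m : nat).
Variables (v : 'I_n -> V) (f : 'I_m -> edge G).
Hypotheses (bij_v : bijective v) (bij_f : bijective f).
Let A := adjmx R G v.
Let B := incmx R v f.

(** Entry (i, j) counts the edges through both [v i] and [v j]: the degree on the diagonal,
    adjacency elsewhere. *)
Lemma incmx_mul_tr (r : nat) : regular G r -> B *m B^T = A + r%:R%:M.
Proof.
move=> regG; apply/matrixP => i j; rewrite !mxE.
have -> : \sum_k B i k * B^T k j =
    #|[set e : edge G | (v i \in ends e) && (v j \in ends e)]|%:R.
  rewrite -sum1_card natr_sum [RHS]big_mkcond /=.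
  rewrite (reindex f) /=; last exact: onW_bij.
  apply: eq_bigr => k _; rewrite !mxE inE.
  by case: (_ \in _); case: (_ \in _); rewrite ?mul1r ?mul0r.
rewrite (card_edge G (fun S => (v i \in S) && (v j \in S))).
have [<-|ij] := eqVneq i j.
  rewrite adj_irr add0r mulr1n -(regG (v i)) -card_incident.
  by congr _%:R; apply: eq_card => S; rewrite !inE andbb.
rewrite mulr0n addr0 card_joining //.
by rewrite (bij_eq bij_v).
Qed.

(** The trace of B B^T = A + r is n r; it is also the trace of B^T B, whose diagonal entries all
    equal 2. *)
Lemma handshake (r : nat) : regular G r -> (n * r = 2 * m)%N.
Proof.
move=> regG; apply/eqP; rewrite -(eqr_nat R); apply/eqP.
transitivity (\tr (B *m B^T)).
  rewrite (incmx_mul_tr regG) raddfD /= mxtrace_scalar.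
  rewrite /mxtrace big1 ?add0r; last by move=> i _; rewrite mxE adj_irr.
  by rewrite mulnC mulrnA.
rewrite mxtrace_mulC /mxtrace (eq_bigr (fun=> 2)) => [|k _].
  by rewrite sumr_const card_ord mulrnA.
rewrite /= mxE -[2%N](card_ends (f k) : _ = 2%N) -sum1_card natr_sum [RHS]big_mkcond /=.
rewrite [RHS](reindex v) /=; last exact: onW_bij.
by apply: eq_bigr => i _; rewrite !mxE; case: (_ \in _); rewrite ?mul1r ?mul0r.
Qed.

(** The entry of u B at the edge joining [v i] and [v j] is u_i + u_j. *)
Lemma incmx_alternating (u : 'rV[R]_n) : u *m B = 0 ->
  forall i j, G (v i) (v j) -> u 0 i = - u 0 j.
Proof.
move=> uB i j ij; have [g gK fK] := bij_f.
set e : edge G := exist (fun S => S \in edges G) _ (mem_edges ij).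
have nij : j != i by apply: contraTneq (ij) => ->; rewrite adj_irr.
have /matrixP/(_ 0 (g e)) := uB; rewrite !mxE.
under eq_bigr do rewrite mxE fK /ends /= !inE !(bij_eq bij_v).
rewrite (bigD1 i) //= (bigD1 j) //= !eqxx orbT !mulr1 big1 => [|k].
  by rewrite addr0 => /eqP; rewrite addr_eq0 => /eqP.
by move=> /andP [/negbTE -> /negbTE ->]; rewrite mulr0.
Qed.

Lemma connected_const (T : Type) (g : 'I_n -> T) : connected G ->
  (forall i j, G (v i) (v j) -> g i = g j) -> forall i j, g i = g j.
Proof.
move=> [_ conG] gG i j; have [w vK wK] := bij_v.
have /connectP [p] := conG (v i) (v j).
suff H x : path G x p -> g (w x) = g (w (last x p)).
  by move=> /H + vj; rewrite -vj !vK.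
elim: p x => //= y p IHp x /andP [xy /IHp <-].
by apply: gG; rewrite !wK.
Qed.

(** * The eigenvalue -r of a regular connected graph *)

Section Regular.
Variable r : nat.
Hypotheses (regG : regular G r) (connG : connected G).

(** For an eigenvector u, (a + r) |u|^2 = |u B|^2. *)
Lemma regular_eigenvalue_ge (a : R) : eigenvalue A a -> 0 <= a + r%:R.
Proof.
case/eigenvalueP => u uA u0.
have tu : (a + r%:R) * \tr (u *m u^T) = \tr ((u *m B) *m (u *m B)^T).
  rewrite trmx_mul mulmxA -(mulmxA u) (incmx_mul_tr regG) mulmxDr uA.
  by rewrite mul_mx_scalar -scalerDl -scalemxAl mxtraceZ.
have uu : 0 < \tr (u *m u^T).
  rewrite lt_def mxtrace_mul_tr_ge0 andbT.
  by apply: contraNneq u0 => /mxtrace_mul_tr_eq0 ->.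
by rewrite -(pmulr_lge0 _ uu) tu mxtrace_mul_tr_ge0.
Qed.

Lemma eigenvector_opp_degree (u : 'rV[R]_n) :
  u *m A = - r%:R *: u -> u *m B = 0.
Proof.
move=> uA; apply: mxtrace_mul_tr_eq0.
rewrite trmx_mul mulmxA -(mulmxA u) (incmx_mul_tr regG) mulmxDr uA.
by rewrite mul_mx_scalar -scalerDl addNr scale0r mul0mx mxtrace0.
Qed.

(** An eigenvector for -r changes sign along edges, so its squared entries are constant by
    connectedness. Its only possible values c and -c then cut out the two classes. *)
Lemma eigenvalue_opp_degree_bipartite :
  eigenvalue A (- r%:R) -> bipartite G.
Proof.
case/eigenvalueP => u /eigenvector_opp_degree uB u0; have [w vK wK] := bij_v.
have alt := incmx_alternating uB.
have sq i j : u 0 i ^+ 2 = u 0 j ^+ 2.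
  apply: (connected_const (g := fun i => u 0 i ^+ 2)) => // {}i {}j /alt ->.
  by rewrite sqrrN.
have [k uk] : exists k, u 0 k != 0.
  apply/existsP; rewrite -negb_forall; apply: contra u0 => /forallP z.
  by apply/eqP/rowP => i; rewrite mxE; apply/eqP.
pose c := u 0 k; have cN : c != - c by rewrite -addr_eq0 -mulr2n mulrn_eq0.
have cases x : (u 0 (w x) == c) || (u 0 (w x) == - c).
  by rewrite -eqf_sqr; apply/eqP/sq.
exists [set x | u 0 (w x) == c], [set x | u 0 (w x) == - c]; split.
- by apply/setP => x; rewrite !inE cases.
- apply/pred0P => x /=; rewrite !inE; apply/negP => /andP [/eqP -> /eqP].
  by move/eqP: cN.
move=> x y xy; rewrite !inE.
rewrite (alt (w x) (w y)) ?wK //.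
by have := cases y; rewrite !eqr_oppLR opprK; case: eqP; case: eqP.
Qed.

Lemma alternating_eigenvector (s : 'rV[R]_n) :
  (forall i j, G (v i) (v j) -> s 0 i = - s 0 j) -> s *m A = - r%:R *: s.
Proof.
move=> alt; apply/rowP => j; rewrite !mxE -(regG (v j)) -sum1_card natr_sum.
rewrite (big_mkcond (fun y => y \in _)) (reindex v) /=; last exact: onW_bij.
rewrite -sumrN mulr_suml; apply: eq_bigr => i _; rewrite mxE inE adj_sym.
by case: ifP => [/alt ->|_]; rewrite ?oppr0 ?mulr0 ?mul0r // mulr1 mulN1r opprK.
Qed.

(** The vector s belongs to -r and the all-one vector to r; these numbers differ because r > 0, so
    the vectors are orthogonal. *)
Lemma alternating_sum (s : 'rV[R]_n) : (0 < r)%N ->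
  (forall i j, G (v i) (v j) -> s 0 i = - s 0 j) -> \sum_i s 0 i = 0.
Proof.
move=> r0 alt; pose one : 'cV[R]_n := const_mx 1.
have oneA : A *m one = r%:R *: one.
  apply/colP => i; rewrite !mxE mulr1 -(regG (v i)) -sum1_card natr_sum.
  rewrite [RHS]big_mkcond [RHS](reindex v) /=; last exact: onW_bij.
  by apply: eq_bigr => j _; rewrite !mxE inE mulr1; case: (G _ _).
have : s *m one = 0.
  apply: eigenvector_orth (alternating_eigenvector alt) oneA.
  by rewrite eq_sym -addr_eq0 -natrD pnatr_eq0 -lt0n addn_gt0 r0.
move/matrixP/(_ 0 0); rewrite !mxE => s1; rewrite -[RHS]s1.
by apply: eq_bigr => i _; rewrite mxE mulr1.
Qed.

(* Connectedness makes the (-r)-eigenspace a line, spanned by any alternating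
   sign vector. *)
Lemma eigenprojector_opp_degree (s : 'rV[R]_n) (E : 'M[R]_n) :
  (forall i, s 0 i ^+ 2 = 1) ->
  (forall i j, G (v i) (v j) -> s 0 i = - s 0 j) ->
  eigenprojector A (- r%:R) E -> E = n%:R^-1 *: (s^T *m s).
Proof.
move=> s2 alt EP; have symA := trmx_adjmx R G v.
(* Every row of E lies in the (-r)-eigenspace, so it alternates like s and its entrywise product
   with s is constant. *)
have rowE k i j : E k i * s 0 i = E k j * s 0 j.
  apply: (connected_const (g := fun i => E k i * s 0 i)) => // {}i {}j ij.
  have rA : row k E *m A = - r%:R *: row k E.
    by rewrite -row_mul (eigenprojector_mull symA EP) linearZ.
  have := incmx_alternating (eigenvector_opp_degree rA) ij.
  rewrite !mxE => ->; by rewrite (alt i j ij) mulrNN.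
have symE i j : E i j = E j i by rewrite -[in LHS](eigenprojector_tr EP) mxE.
have sE := eigenprojector_fix symA EP (alternating_eigenvector alt).
have s2' i : s 0 i * s 0 i = 1 by rewrite -expr2 s2.
apply/matrixP => i j; rewrite !mxE big_ord1 mxE.
have n0 : n%:R != 0 :> R.
  by rewrite pnatr_eq0 -lt0n; apply: leq_ltn_trans (ltn_ord i).
apply: (mulfI n0); rewrite mulrA divff // mul1r.
(* Expanding s_j as an entry of s E, and n as a sum of ones, reduces n E_ij = s_i s_j to one
   identity for each index k. *)
have /rowP/(_ j) := sE; rewrite mxE => sj.
rewrite -{}sj mulr_sumr -[n in n%:R](card_ord n) -sumr_const mulr_suml.
apply: eq_bigr => k _; rewrite mul1r.
apply: (mulIf (x := s 0 j)); first by rewrite -sqrf_eq0 s2 oner_eq0.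
rewrite (rowE i j k) -!mulrA (rowE k j i) (symE k i).
have -> : s 0 i * (s 0 k * (E i k * s 0 i)) =
    s 0 i * s 0 i * (E i k * s 0 k) by ring.
by rewrite s2' mul1r.
Qed.

End Regular.
End Incidence.

(** * Resolutions of the identity and the numbers lambda_{i+-} *)

Section Resolution.
Variables (R : fieldType) (N : nat) (A : 'M[R]_N) (I : finType) (P : pred I).
Variables (mu : I -> R) (F : I -> 'M[R]_N).
Hypotheses (muI : {in P &, injective mu}) (sumF : \sum_(i | P i) F i = 1%:M).
Hypothesis AF : forall i, P i -> A *m F i = mu i *: F i.

Lemma resolution_sum : A = \sum_(i | P i) mu i *: F i.
Proof. by rewrite -[LHS]mulmx1 -sumF mulmx_sumr; apply: eq_bigr. Qed.

Lemma resolution_fix (u : 'rV_N) i : P i -> u *m A = mu i *: u -> u *m F i = u.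
Proof.
move=> Pi uA; rewrite -[RHS]mulmx1 -sumF mulmx_sumr (bigD1 i) //= big1 ?addr0 //.
move=> j /andP [Pj ji]; apply: (eigenvector_orth _ uA (AF Pj)).
by rewrite (inj_in_eq muI) // eq_sym.
Qed.

(** An eigenvector has some nonzero component u F_i, and orthogonality forces a = mu_i there. The
    clause on [F i] matters because a term of the resolution may vanish. *)
Lemma resolution_eigenvalue (a : R) : eigenvalue A a ->
  exists i, [/\ P i, a = mu i & F i != 0].
Proof.
case/eigenvalueP => u uA u0.
have [|H] := boolP [exists i, [&& P i, a == mu i & F i != 0]].
  by case/existsP => i /and3P [Pi /eqP ai Fi]; exists i.
case/eqP: u0; rewrite -[LHS]mulmx1 -sumF mulmx_sumr big1 // => i Pi.
have [ai|ai] := eqVneq a (mu i); last exact: eigenvector_orth ai uA (AF Pi).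
have [->|Fi] := eqVneq (F i) 0; first by rewrite mulmx0.
by case/negP: H; apply/existsP; exists i; rewrite Pi ai eqxx.
Qed.

End Resolution.

Section LamQ.
Variables (R : rcfType) (r : nat).

(** The coefficient c of the eigenvector (c u, B^T u) of A(Q(G)), the same as in [FQ]. *)
Definition cQ (l : R) (s : bool) : R := lamQ r l s + 2 - r%:R - l.

(** With t = l + r this is the quadratic equation x (x + 2 - t) = t solved by x = lambda_{i+-}; it
    is the vertex part of the eigenvector equation. *)
Lemma lamQ_mul_cQ (l : R) s : lamQ r l s * cQ l s = l + r%:R.
Proof.
have rad_ge0 : 0 <= (l + r%:R) ^+ 2 + 4 by rewrite addr_ge0 ?sqr_ge0.
have := sqr_sqrtr rad_ge0.
rewrite /cQ /lamQ; set q := Num.sqrt _.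
case: s; rewrite ?expr1 ?expr0; move: (r%:R) => t q2; nra.
Qed.

Lemma lamQ_lt (l : R) : lamQ r l true < lamQ r l false.
Proof.
rewrite /lamQ expr0 expr1; set q := Num.sqrt _.
have : 0 < q by rewrite sqrtr_gt0 ltr_wpDl ?sqr_ge0.
move: (r%:R) => t; lra.
Qed.

(** Subtracting the quadratic equations of a common root x leaves (x + 1)(l - l') = 0, and x = -1
    would turn either equation into -1 = 0. The sign is then read off from [lamQ_lt]. *)
Lemma lamQ_inj (l l' : R) s s' : lamQ r l s = lamQ r l' s' -> l = l' /\ s = s'.
Proof.
move=> E; have ll : l = l'.
  have := lamQ_mul_cQ l s; have := lamQ_mul_cQ l' s'; rewrite /cQ -E.
  move: (lamQ r l s) (r%:R) => x t H1 H2.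
  have : (x + 1) * (l - l') = 0 by nra.
  move/eqP; rewrite mulf_eq0 subr_eq0 => /orP [|/eqP //].
  rewrite addr_eq0 => /eqP xE; subst x; nra.
split=> //; subst l'; have := lamQ_lt l.
by case: s s' E => [] [] //= ->; rewrite ltxx.
Qed.

(** The two values of c are the roots of c^2 + (t - 2) c - t. The product -t expresses that the
    vectors (c u, B^T u) for the two signs are orthogonal. *)
Lemma cQ_prod (l : R) : cQ l false * cQ l true = - (l + r%:R).
Proof.
have rad_ge0 : 0 <= (l + r%:R) ^+ 2 + 4 by rewrite addr_ge0 ?sqr_ge0.
have := sqr_sqrtr rad_ge0.
rewrite /cQ /lamQ expr0 expr1; set q := Num.sqrt _.
move: (r%:R) => t q2; nra.
Qed.

Section Pos.
Variable l : R.
Hypothesis t_gt0 : 0 < l + r%:R.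

Lemma lamQ_neq_m2 s : lamQ r l s != -2.
Proof.
apply/eqP => E; have := lamQ_mul_cQ l s; rewrite /cQ E.
by move: (r%:R) t_gt0 => t; lra.
Qed.

Lemma lamQ_neq0 s : lamQ r l s != 0.
Proof.
apply/eqP => E; have := lamQ_mul_cQ l s; rewrite E mul0r.
by move: (r%:R) t_gt0 => t; lra.
Qed.

Lemma cQ_neq0 s : cQ l s != 0.
Proof.
apply/eqP => E; have := lamQ_mul_cQ l s; rewrite E mulr0.
by move: (r%:R) t_gt0 => t; lra.
Qed.

Lemma denQ_gt0 s : 0 < cQ l s ^+ 2 + l + r%:R.
Proof. by rewrite -addrA ltr_wpDl ?sqr_ge0. Qed.

Let p := cQ l false.
Let q := cQ l true.

Lemma cQ_sub_neq0 : p - q != 0.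
Proof.
rewrite /p /q /cQ; have := lamQ_lt l; rewrite -subr_gt0 => /lt0r_neq0.
by congr (_ != 0); move: (r%:R) => t; ring.
Qed.

(** Substituting t = -p q factors the denominators, after which the sums in [sum_denQ] are rational
    identities in p and q. *)
Lemma denQ_false : cQ l false ^+ 2 + l + r%:R = p * (p - q).
Proof.
by have := cQ_prod l; rewrite -/p -/q => pq; rewrite -addrA mulrBr pq opprK.
Qed.

Lemma denQ_true : cQ l true ^+ 2 + l + r%:R = - q * (p - q).
Proof.
have := cQ_prod l; rewrite -/p -/q -addrA => pq; rewrite -[_ + r%:R]opprK -pq.
ring.
Qed.

(** These are the block coefficients of F_{i+} + F_{i-}, which is therefore block diagonal with
    blocks E_i and t^-1 B^T E_i B. *)
Lemma sum_denQ :
  [/\ \sum_s (cQ l s ^+ 2 + l + r%:R)^-1 = (l + r%:R)^-1,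
      \sum_s (cQ l s ^+ 2 + l + r%:R)^-1 * cQ l s = 0
    & \sum_s (cQ l s ^+ 2 + l + r%:R)^-1 * cQ l s ^+ 2 = 1].
Proof.
have p0 : p != 0 := cQ_neq0 _; have q0 : q != 0 := cQ_neq0 _.
have pq0 := cQ_sub_neq0.
have tE : l + r%:R = - (p * q) by rewrite cQ_prod opprK.
rewrite !big_bool /= denQ_false denQ_true -/p -/q tE.
by split; field; rewrite ?oppr_eq0 p0 q0 pq0.
Qed.

End Pos.
End LamQ.

(** * Eigenvectors of A(Q(G)) *)

Lemma sum_block_mx (R : nmodType) (I : finType) (P : pred I) (m1 m2 n1 n2 : nat)
    (Aul : I -> 'M[R]_(m1, n1)) (Aur : I -> 'M[R]_(m1, n2))
    (Adl : I -> 'M[R]_(m2, n1)) (Adr : I -> 'M[R]_(m2, n2)) :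
  \sum_(i | P i) block_mx (Aul i) (Aur i) (Adl i) (Adr i) =
  block_mx (\sum_(i | P i) Aul i) (\sum_(i | P i) Aur i)
           (\sum_(i | P i) Adl i) (\sum_(i | P i) Adr i).
Proof.
elim: (index_enum I) => [|i e IHe]; first by rewrite !big_nil block_mx0.
by rewrite !big_cons; case: (P i); rewrite // IHe add_block_mx.
Qed.

Lemma trmx_scale (R : comPzRingType) (p q : nat) (a : R) (M : 'M[R]_(p, q)) :
  (a *: M)^T = a *: M^T.
Proof. exact: linearZ. Qed.

(** Any nonzero column of [H] is an eigenvector; symmetry turns it into a row. *)
Lemma eigenvalue_mul_neq0 (R : fieldType) (n : nat) (M H : 'M[R]_n) (a : R) :
  M^T = M -> M *m H = a *: H -> H != 0 -> eigenvalue M a.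
Proof.
move=> symM MH /eqP H0; have [j Hj] : exists j, col j H != 0.
  apply/existsP; rewrite -negb_forall; apply/negP => /forallP z; apply: H0.
  by apply/matrixP => i j; have /eqP/colP/(_ i) := z j; rewrite !mxE.
apply/eigenvalueP; exists (col j H)^T; last by rewrite trmx_eq0.
by rewrite -{1}symM -trmx_mul -trmx_scale colE mulmxA MH scalemxAl.
Qed.

(** * Eigenprojectors of A(Q(G)), both cases at once *)

Section Core.
Variables (R : rcfType) (n m r q : nat) (I : finType) (P : pred I).
Variables (A K : 'M[R]_n) (B : 'M[R]_(n, m)) (lam : I -> R) (E : I -> 'M[R]_n).
Variable zeta : 'I_q -> 'cV[R]_m.
Hypotheses (symA : A^T = A) (BBt : B *m B^T = A + r%:R%:M).
Hypotheses (lamI : injective lam) (lam_gt0 : forall i, P i -> 0 < lam i + r%:R).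
Hypotheses (EP : forall i, eigenprojector A (lam i) (E i)).
Hypotheses (KP : eigenprojector A (- r%:R) K).
Hypotheses (sumEK : \sum_(i | P i) E i + K = 1%:M).
Hypotheses (oz : orthonormal_family zeta) (Bz : forall k, B *m zeta k = 0).
(** The range of [K] is the kernel of B B^T = A + r, so B has rank n - tr K and the [zeta k] span
    its kernel. The trace of [K] is 0 in the non-bipartite case and 1 in the bipartite case. *)
Hypothesis rank_ker : q%:R + n%:R = m%:R + \tr K.

Let AQ := block_mx 0 B B^T (B^T *m B - 2%:M).
Let Z := \sum_k zeta k *m (zeta k)^T.
Let F i s := FQ r B (lam i) (E i) s.
Let K0 : 'M[R]_(n + m) := block_mx K 0 0 0.

Lemma trmx_AQ : AQ^T = AQ.
Proof.
by rewrite tr_block_mx trmx0 trmxK linearB /= trmx_mul trmxK tr_scalar_mx.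
Qed.

(** The squared norm of K B is the trace of K (A + r) K, which vanishes. *)
Lemma tr_K_mul : B^T *m K = 0.
Proof.
rewrite -[B^T *m K]trmxK -[RHS]trmx0; congr (_^T); apply: mxtrace_mul_tr_eq0.
rewrite trmxK trmx_mul (eigenprojector_tr KP) trmxK mulmxA -(mulmxA K) BBt.
rewrite mulmxDr (eigenprojector_mull symA KP) mul_mx_scalar -scalerDl addNr.
by rewrite scale0r mul0mx mxtrace0.
Qed.

Lemma FQ_m2E : FQ_m2 n zeta = block_mx 0 0 0 Z.
Proof.
rewrite /FQ_m2 (eq_bigr (fun k => block_mx 0 0 0 (zeta k *m (zeta k)^T))).
  by rewrite sum_block_mx !big1_eq.
by move=> k _; rewrite /sqnorm oz eqxx invr1 scale1r.
Qed.

(* The complement of the left-hand side is a symmetric idempotent, and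
   [rank_ker] makes its trace vanish. *)
Lemma row_space_resolution :
  B^T *m (\sum_(i | P i) (lam i + r%:R)^-1 *: E i) *m B + Z = 1%:M.
Proof.
set W := \sum_(i | P i) _; set Q := _ *m B.
have symW : W^T = W.
  rewrite linear_sum; apply: eq_bigr => i _ /=.
  by rewrite trmx_scale (eigenprojector_tr (EP i)).
(* W inverts B B^T off the range of K, which makes Q the projector onto the row space of B. *)
have BBW : B *m B^T *m W = 1%:M - K.
  rewrite -sumEK addrK mulmx_sumr; apply: eq_bigr => i Pi.
  rewrite BBt -scalemxAr mulmxDl (eigenprojector_mulr symA (EP i)) mul_scalar_mx.
  by rewrite -scalerDl scalerA mulVf ?scale1r // gt_eqF ?lam_gt0.
have KB : K *m B = 0.
  by rewrite -[LHS]trmxK trmx_mul (eigenprojector_tr KP) tr_K_mul trmx0.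
have BQ : B *m Q = B by rewrite /Q !mulmxA BBW mulmxBl mul1mx KB subr0.
have symQ : Q^T = Q by rewrite /Q !trmx_mul trmxK symW mulmxA.
have BZ : B *m Z = 0.
  by rewrite mulmx_sumr big1 // => k _; rewrite mulmxA Bz mul0mx.
have QQ : Q *m Q = Q by rewrite {1}/Q -!mulmxA BQ mulmxA.
have QZ : Q *m Z = 0 by rewrite {1}/Q -!mulmxA BZ !mulmx0.
have symZ : Z^T = Z := tr_sum_outer zeta.
have ZQ : Z *m Q = 0 by rewrite -[LHS]trmxK trmx_mul symZ symQ QZ trmx0.
have ZZ : Z *m Z = Z := orthonormal_idem oz.
set D := 1%:M - (Q + Z); suff : D = 0 by move/eqP; rewrite subr_eq0 => /eqP.
apply: mxtrace_mul_tr_eq0.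
have -> : D *m D^T = D.
  have -> : D^T = D by rewrite /D !linearB !linearD /= tr_scalar_mx symQ symZ.
  rewrite {2}/D mulmxBr mulmx1 {2}/D mulmxBl mul1mx mulmxDl !mulmxDr.
  by rewrite QQ QZ ZQ ZZ addr0 add0r subrr subr0.
rewrite /D linearB linearD /= mxtrace_scalar (orthonormal_trace oz).
(* By cyclicity tr Q = tr (1 - K) = n - tr K, while tr Z = q. *)
rewrite /Q mxtrace_mulC mulmxA BBW linearB /= mxtrace_scalar.
apply/eqP; rewrite subr_eq0; apply/eqP.
have := rank_ker; move: (q%:R) (n%:R) (m%:R) (\tr K) => a b c e; lra.
Qed.

(** By [sum_denQ] the off-diagonal blocks cancel; the vertex block is [sumEK] and the edge block is
    [row_space_resolution]. *)
Lemma sum_FQ : \sum_(i | P i) \sum_s F i s + FQ_m2 n zeta + K0 = 1%:M.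
Proof.
have FE i s : F i s = let c := cQ r (lam i) s in let D := c ^+ 2 + lam i + r%:R in
    block_mx ((D^-1 * c ^+ 2) *: E i) ((D^-1 * c) *: (E i *m B))
      ((D^-1 * c) *: (E i *m B)^T) (D^-1 *: (B^T *m E i *m B)).
  by rewrite /F /FQ -/(cQ r (lam i) s) /= scale_block_mx !scalerA.
rewrite (eq_bigr (fun i => block_mx (E i) 0 0
    (B^T *m ((lam i + r%:R)^-1 *: E i) *m B))) => [|i Pi].
  rewrite sum_block_mx FQ_m2E !add_block_mx !addr0 !big1_eq ?addr0 sumEK.
  rewrite -mulmx_suml -mulmx_sumr row_space_resolution.
  by rewrite -scalar_mx_block.
under eq_bigr do rewrite FE /=.
rewrite sum_block_mx -!scaler_suml.
have [-> -> ->] := sum_denQ (lam_gt0 Pi).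
by rewrite scale1r !scale0r -scalemxAr -scalemxAl.
Qed.

Lemma FQ_eigenprojector_basis i s : P i ->
  exists k (y : 'I_k -> 'cV[R]_(n + m)), [/\ orthonormal_family y,
    forall j, AQ *m y j = lamQ r (lam i) s *: y j
    & F i s = \sum_j y j *m (y j)^T].
Proof.
move=> Pi; have D0 := denQ_gt0 (lam_gt0 Pi) s.
have [k [x [ox _ EE]]] := EP i.
have Ax j : A *m x j = lam i *: x j.
  have Ex : E i *m x j = x j.
    rewrite -[LHS]trmxK trmx_mul (eigenprojector_tr (EP i)) EE.
    by rewrite orthonormal_sum ?trmxK.
  by rewrite -Ex mulmxA (eigenprojector_mulr symA (EP i)) -scalemxAl.
have BBx j : B *m (B^T *m x j) = (lam i + r%:R) *: x j.
  by rewrite mulmxA BBt mulmxDl Ax mul_scalar_mx -scalerDl.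
set c := cQ r (lam i) s in D0; set D := _ + _ in D0.
have tE := lamQ_mul_cQ r (lam i) s; rewrite -/c in tE.
have sD : (Num.sqrt D)^-1 * (Num.sqrt D)^-1 = D^-1.
  by rewrite -invfM -expr2 sqr_sqrtr // ltW.
(* B B^T x_j = t x_j gives (c x_j, B^T x_j) the squared norm c^2 + t = D, whence the
   normalization. *)
exists k, (fun j => (Num.sqrt D)^-1 *: col_mx (c *: x j) (B^T *m x j)); split.
- move=> j l; set y := (X in (X^T *m _) 0 0); set y' := (X in (_ *m X) 0 0).
  suff -> : y^T *m y' = (j == l)%:R%:M by rewrite mxE eqxx mulr1n.
  rewrite {}/y {}/y'.
  rewrite trmx_scale -scalemxAl -scalemxAr scalerA sD tr_col_mx mul_row_col.
  rewrite trmx_scale -scalemxAl -scalemxAr trmx_mul trmxK -mulmxA BBx.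
  rewrite -scalemxAr orthonormal_mul // scalerA -scalerDl -expr2 addrA -/D.
  by rewrite scalerA mulVf ?scale1r // gt_eqF.
- move=> j; rewrite -scalemxAr [RHS]scalerA [in RHS]mulrC -[RHS]scalerA; congr (_ *: _).
  (* The upper block needs x c = t, the lower one x = c - 2 + t. *)
  rewrite mul_block_col scale_col_mx mul0mx add0r BBx scalerA tE.
  rewrite mulmxBl -mulmxA BBx mul_scalar_mx -!scalemxAr -scalerBl -scalerDl.
  congr (col_mx _ (_ *: _)); rewrite /c /cQ; ring.
rewrite /F /FQ -/(cQ r (lam i) s) /= -/c -/D.
under [RHS]eq_bigr do rewrite trmx_scale -scalemxAl -scalemxAr scalerA sD
  tr_col_mx mul_col_row.
rewrite -scaler_sumr sum_block_mx; congr (_ *: block_mx _ _ _ _).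
- rewrite EE scaler_sumr; apply: eq_bigr => j _.
  by rewrite trmx_scale -scalemxAl -scalemxAr scalerA.
- rewrite EE mulmx_suml scaler_sumr; apply: eq_bigr => j _.
  by rewrite trmx_mul trmxK -scalemxAl mulmxA.
- rewrite trmx_mul (eigenprojector_tr (EP i)) EE mulmx_sumr scaler_sumr.
  by apply: eq_bigr => j _; rewrite trmx_scale -scalemxAr mulmxA.
- rewrite EE mulmx_sumr mulmx_suml; apply: eq_bigr => j _.
  by rewrite trmx_mul trmxK !mulmxA.
Qed.

Lemma mul_AQ_FQ i s : P i -> AQ *m F i s = lamQ r (lam i) s *: F i s.
Proof.
move=> /(FQ_eigenprojector_basis s) [k [y [_ Ay ->]]].
rewrite mulmx_sumr scaler_sumr; apply: eq_bigr => j _.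
by rewrite mulmxA Ay scalemxAl.
Qed.

Lemma mul_AQ_zeta k : AQ *m col_mx 0 (zeta k) = -2 *: col_mx 0 (zeta k).
Proof.
rewrite mul_block_col scale_col_mx !mulmx0 !add0r Bz scaler0 mulmxBl -mulmxA Bz.
by rewrite mulmx0 sub0r mul_scalar_mx scaleNr.
Qed.

Lemma FQ_m2_outer : FQ_m2 n zeta =
  \sum_k col_mx 0 (zeta k) *m (col_mx 0 (zeta k))^T.
Proof.
rewrite FQ_m2E; under [RHS]eq_bigr do
  rewrite tr_col_mx mul_col_row trmx0 !mulmx0 mul0mx.
by rewrite sum_block_mx !big1_eq.
Qed.

Lemma mul_AQ_K0 : AQ *m K0 = 0 *: K0.
Proof.
by rewrite mulmx_block !mul0mx !mulmx0 tr_K_mul !addr0 scale0r block_mx0.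
Qed.

(* All eigenvalues of [AQ] under one index: those with [inl] are the
   lambda_{i+-}, [inr true] is -2 and [inr false] is 0. *)
Let J : finType := ((I * bool) + bool)%type.
Let PJ (j : J) := if j is inl p then P p.1 else true.
Let muJ (j : J) : R :=
  match j with inl p => lamQ r (lam p.1) p.2 | inr true => -2 | inr false => 0 end.
Let FJ (j : J) :=
  match j with inl p => F p.1 p.2 | inr true => FQ_m2 n zeta | inr false => K0 end.

Let muJ_inj : {in PJ &, injective muJ}.
Proof.
have m20 : -2 != 0 :> R by rewrite oppr_eq0 pnatr_eq0.
move=> [[i s]|[]] [[j s']|[]] //=; rewrite !unfold_in /= => Pi Pj.
- by move=> /lamQ_inj [/lamI -> ->].
- by move/eqP; rewrite (negbTE (lamQ_neq_m2 (lam_gt0 Pi) _)).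
- by move/eqP; rewrite (negbTE (lamQ_neq0 (lam_gt0 Pi) _)).
- by move/esym/eqP; rewrite (negbTE (lamQ_neq_m2 (lam_gt0 Pj) _)).
- by move/eqP; rewrite (negbTE m20).
- by move/esym/eqP; rewrite (negbTE (lamQ_neq0 (lam_gt0 Pj) _)).
- by move/esym/eqP; rewrite (negbTE m20).
Qed.

Let big_J (H : J -> 'M[R]_(n + m)) : \sum_(j | PJ j) H j =
  \sum_(i | P i) \sum_s H (inl (i, s)) + H (inr true) + H (inr false).
Proof.
rewrite big_sumType /= big_bool addrA; congr (_ + _ + _).
rewrite pair_big_dep; apply: eq_big => [[i s]|[i s]] //=; by rewrite andbT.
Qed.

Let sumFJ : \sum_(j | PJ j) FJ j = 1%:M.
Proof. by rewrite big_J /= sum_FQ. Qed.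

Let AFJ j : PJ j -> AQ *m FJ j = muJ j *: FJ j.
Proof.
case: j => [[i s]|[]] /=; first exact: mul_AQ_FQ; last by rewrite mul_AQ_K0.
move=> _; rewrite FQ_m2_outer mulmx_sumr scaler_sumr; apply: eq_bigr => k _.
by rewrite mulmxA mul_AQ_zeta scalemxAl.
Qed.

Lemma AQ_sum : AQ = \sum_(i | P i) \sum_s lamQ r (lam i) s *: F i s
  + -2 *: FQ_m2 n zeta.
Proof. by rewrite [LHS](resolution_sum sumFJ AFJ) big_J /= scale0r addr0. Qed.

(** Completeness of the basis comes from the resolution of the identity, in which only this term can
    act on an eigenvector for this number. *)
Lemma FQ_eigenprojector i s : P i -> eigenprojector AQ (lamQ r (lam i) s) (F i s).
Proof.
move=> Pi; have [k [y [oy Ay FE]]] := FQ_eigenprojector_basis s Pi.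
rewrite FE; apply: eigenprojectorI => //; first exact: trmx_AQ.
rewrite -FE => u; exact: (resolution_fix muJ_inj sumFJ AFJ (i := inl (i, s))).
Qed.

Lemma FQ_m2_eigenprojector : eigenprojector AQ (-2) (FQ_m2 n zeta).
Proof.
rewrite FQ_m2_outer; apply: eigenprojectorI.
- exact: trmx_AQ.
- by move=> k l; rewrite tr_col_mx mul_row_col trmx0 mul0mx add0r.
- exact: mul_AQ_zeta.
rewrite -FQ_m2_outer => u; exact: (resolution_fix muJ_inj sumFJ AFJ (i := inr true)).
Qed.

Lemma FQ_0_eigenprojector : eigenprojector AQ 0 (block_mx K 0 0 0).
Proof.
have [k [x [ox _ KE]]] := KP.
have K0E : K0 = \sum_j col_mx (x j) 0 *m (col_mx (x j) 0)^T.
  under [RHS]eq_bigr do rewrite tr_col_mx mul_col_row trmx0 !mulmx0 mul0mx.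
  by rewrite sum_block_mx !big1_eq -KE.
rewrite -/K0 K0E; apply: eigenprojectorI.
- exact: trmx_AQ.
- by move=> j l; rewrite tr_col_mx mul_row_col trmx0 mul0mx addr0.
- move=> j; rewrite mul_block_col !mulmx0 mul0mx !addr0 scale0r.
  have Kx : K *m x j = x j.
    rewrite -[LHS]trmxK trmx_mul (eigenprojector_tr KP) KE.
    by rewrite orthonormal_sum ?trmxK.
  by rewrite -Kx mulmxA tr_K_mul mul0mx col_mx0.
rewrite -K0E => u; exact: (resolution_fix muJ_inj sumFJ AFJ (i := inr false)).
Qed.

(** A number of the resolution occurs exactly when its projector is nonzero, which is a genuine
    condition for -2 and for 0. *)
Lemma eigenvalue_AQ (a : R) : (forall i, E i != 0) ->
  eigenvalue AQ a <-> (exists i s, P i /\ a = lamQ r (lam i) s)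
    \/ (a = -2 /\ (0 < q)%N) \/ (a = 0 /\ K != 0).
Proof.
move=> E0; split.
  case/(resolution_eigenvalue sumFJ AFJ) => -[[i s]|[]] [Pj -> Fj] /=.
  - by left; exists i, s.
  - right; left; split=> //; rewrite lt0n; apply: contraNneq Fj => q0 /=.
    by rewrite FQ_m2_outer big1 // => k; have := ltn_ord k; rewrite {2}q0.
  by right; right; split=> //; apply: contraNneq Fj => /= K_0; rewrite /K0 K_0 block_mx0.
case=> [[i [s [Pi ->]]]|[[-> q0]|[-> K0']]].
- apply: (eigenvalue_mul_neq0 trmx_AQ (mul_AQ_FQ s Pi)).
  (* The upper left block is a multiple of E_i by a nonzero factor, since c is nonzero. *)
  apply: contraNneq (E0 i) => /eqP; rewrite /F /FQ scaler_eq0 invr_eq0.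
  rewrite (gt_eqF (denQ_gt0 (lam_gt0 Pi) s)) /= -(block_mx0 R n m n m) => /eqP.
  move=> /eq_block_mx [/eqP + _ _ _]; rewrite scaler_eq0 sqrf_eq0.
  by rewrite (negbTE (cQ_neq0 (lam_gt0 Pi) s)).
- have Fne : FQ_m2 n zeta != 0.
    apply/eqP => F0; have := orthonormal_trace oz.
    move: F0; rewrite FQ_m2E -(block_mx0 R n m n m) => /eq_block_mx [_ _ _ Z0].
    rewrite -/Z Z0 mxtrace0 => /esym/eqP; rewrite pnatr_eq0.
    by move/eqP => q_0; rewrite q_0 in q0.
  exact: (eigenvalue_mul_neq0 trmx_AQ (AFJ (j := inr true) isT) Fne).
apply: (eigenvalue_mul_neq0 trmx_AQ mul_AQ_K0).
apply: contraNneq K0' => /eqP; rewrite /K0 -(block_mx0 R n m n m) => /eqP.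
by case/eq_block_mx => ->.
Qed.

End Core.

(** * The non-bipartite and bipartite cases *)

Lemma eigenprojector0 (R : rcfType) (n : nat) (A : 'M[R]_n) (a : R) :
  A^T = A -> ~~ eigenvalue A a -> eigenprojector A a 0.
Proof.
move=> symA; rewrite /eigenvalue negbK => /eqP A0.
exists 0%N, (fun=> 0); split; first by case.
- by rewrite symA A0 flatmx0 !sub0mx.
- by rewrite big_ord0.
Qed.

Lemma eigenprojector_neq0 (R : rcfType) (n : nat) (A E : 'M[R]_n) (a : R) :
  A^T = A -> eigenvalue A a -> eigenprojector A a E -> E != 0.
Proof.
move=> symA /eigenvalueP [u uA u0] EP; apply: contraNneq u0 => E0.
by rewrite -(eigenprojector_fix symA EP uA) E0 mulmx0.
Qed.

(** Cardinalities decide: if i is in S, so is every j <= i, and |S| > i; otherwise S lies below i,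
    and |S| <= i. *)
Lemma mem_initial_segment (n : nat) (S : {set 'I_n}) :
  (forall i j, i \in S -> j \notin S -> (i < j)%N) ->
  forall i : 'I_n, (i \in S) = (i < #|S|)%N.
Proof.
move=> initS i; have card_lt k : (k <= n)%N -> #|[set j : 'I_n | (j < k)%N]| = k.
  move=> kn; have widenI : injective (widen_ord kn).
    by move=> a b /(congr1 val) /= /val_inj.
  rewrite -[RHS](card_ord k) -(card_imset _ widenI).
  apply: eq_card => j; rewrite inE; apply/idP/imsetP => [jk|[l _ ->]] //=.
  by exists (Ordinal jk) => //; apply: val_inj.
apply/idP/idP => [iS|].
  rewrite -[X in (X <= _)%N](card_lt i.+1 (ltn_ord i)); apply: subset_leq_card.
  apply/subsetP => j; rewrite inE ltnS; apply: contraTT => jS.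
  by rewrite -ltnNge; apply: initS.
apply: contraTT => iS; rewrite -leqNgt -[X in (_ <= X)%N](card_lt i (ltnW (ltn_ord i))).
apply: subset_leq_card; apply/subsetP => j jS; rewrite inE; exact: initS.
Qed.

Theorem theorem3p3 (R : rcfType) (V : finType) (G : sgraph V) (n m r d : nat)
    (v : 'I_n -> V) (f : 'I_m -> edge G)
    (lam : 'I_d.+1 -> R) (E : 'I_d.+1 -> 'M[R]_n)
    (bij_v : bijective v) (bij_f : bijective f)
    (r_ge2 : (2 <= r)%N) (regG : regular G r) (connG : connected G)
    (lam0 : lam ord0 = r%:R)
    (lam_decr : forall i j : 'I_d.+1, (i < j)%N -> lam j < lam i)
    (lamP : forall a : R, eigenvalue (adjmx R G v) a <-> exists i, a = lam i)
    (EP : forall i, eigenprojector (adjmx R G v) (lam i) (E i)) :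
  let RG : 'M[R]_(n, m) := incmx R v f in
  let AQ : 'M[R]_(n + m) := adjmx R (Qgraph G) (Qenum v f) in
  let lamQi (i : 'I_d.+1) (s : bool) : R := lamQ r (lam i) s in
  let F (i : 'I_d.+1) (s : bool) : 'M[R]_(n + m) := FQ r RG (lam i) (E i) s in
  (~ bipartite G ->
   forall zeta : 'I_(m - n) -> 'cV[R]_m,
   orthonormal_family zeta -> (forall k, RG *m zeta k = 0) ->
   let Fm2 : 'M[R]_(n + m) := FQ_m2 n zeta in
   [/\ forall a : R, eigenvalue AQ a <->
         (exists i s, a = lamQi i s) \/ (a = -2 /\ (n < m)%N),
       forall i s, eigenprojector AQ (lamQi i s) (F i s),
       eigenprojector AQ (-2) Fm2
     & AQ = \sum_i \sum_s lamQi i s *: F i s + (-2) *: Fm2])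
  /\
  (forall V1 V2 : {set V}, bipartition G V1 V2 ->
   (forall i j : 'I_n, v i \in V1 -> v j \in V2 -> (i < j)%N) ->
   forall zeta : 'I_(m - n + 1) -> 'cV[R]_m,
   orthonormal_family zeta -> (forall k, RG *m zeta k = 0) ->
   lam ord_max = - r%:R /\
   exists hn : (n./2 + n./2)%N = n,
   let Fm2 : 'M[R]_(n + m) := FQ_m2 n zeta in
   let F0 : 'M[R]_(n + m) := FQ_0 R m hn in
   [/\ forall a : R, eigenvalue AQ a <->
         (exists i s, i != ord_max /\ a = lamQi i s) \/ a = -2 \/ a = 0,
       eigenprojector AQ (-2) Fm2,
       eigenprojector AQ 0 F0 /\ F0 = block_mx (E ord_max) 0 0 0,
       forall i s, i != ord_max -> eigenprojector AQ (lamQi i s) (F i s)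
     & AQ = \sum_(i | i != ord_max) \sum_s lamQi i s *: F i s
            + (-2) *: Fm2 + 0 *: F0]).
Proof.
move=> RG AQ lamQi F.
have AQE : AQ = block_mx 0 RG RG^T (RG^T *m RG - 2%:M).
  exact: adjmx_Qgraph bij_v (bij_inj bij_f).
have symA := trmx_adjmx R G v.
have BBt : RG *m RG^T = adjmx R G v + r%:R%:M := incmx_mul_tr R bij_v bij_f regG.
have lamI : injective lam.
  move=> i j ij; apply: val_inj; case: (ltngtP i j) => // /lam_decr.
    by rewrite ij ltxx.
  by rewrite ij ltxx.
have lam_eig i : eigenvalue (adjmx R G v) (lam i) by apply/lamP; exists i.
have sumE : \sum_i E i = 1%:M by apply: sum_eigenprojectors EP => // a /lamP.
have E_neq0 i : E i != 0 := eigenprojector_neq0 symA (lam_eig i) (EP i).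
have lam_ge i : 0 <= lam i + r%:R := regular_eigenvalue_ge bij_v bij_f regG (lam_eig i).
(* From n r = 2 m and r >= 2; the truncated difference m - n is thus the true one. *)
have nm : (n <= m)%N by have := handshake R bij_v bij_f regG; nia.
split.
  move=> nbip zeta oz Bz Fm2.
  have eigN : ~~ eigenvalue (adjmx R G v) (- r%:R).
    by apply/negP => /(eigenvalue_opp_degree_bipartite bij_v bij_f regG connG).
  have lam_gt i : predT i -> 0 < lam i + r%:R.
    rewrite lt_def lam_ge andbT addr_eq0 => _.
    by apply: contra eigN => /eqP <-.
  (* The general setting is used with K = 0 and with all indices selected. *)
  have KP := eigenprojector0 symA eigN.
  have sumEK : \sum_(i | predT i) E i + 0 = 1%:M by rewrite addr0.
  have rk : (m - n)%:R + n%:R = m%:R + \tr (0 : 'M[R]_n).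
    by rewrite mxtrace0 addr0 -natrD subnK.
  rewrite AQE; split.
  - move=> a.
    rewrite (eigenvalue_AQ symA BBt lam_gt EP KP sumEK oz Bz rk a E_neq0).
    rewrite eqxx subn_gt0; split=> [[[i [s [_ ->]]]|[am2|[_ //]]]|[[i [s ->]]|am2]].
    + by left; exists i, s.
    + by right.
    + by left; exists i, s.
    + by right; left.
  - by move=> i s; apply: (FQ_eigenprojector symA BBt lamI lam_gt EP KP sumEK oz Bz rk).
  - exact: (FQ_m2_eigenprojector symA BBt lamI lam_gt EP KP sumEK oz Bz rk).
  - exact: (AQ_sum symA BBt lam_gt EP KP sumEK oz Bz rk).
move=> V1 V2 [V12 dV12 bip] ordV zeta oz Bz.
have V2E x : (x \in V2) = (x \notin V1).
  have /setP/(_ x) := V12; rewrite !inE; case xV1: (x \in V1) => //= _.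
  exact: disjointFr dV12 xV1.
(* The sign vector of the bipartition: 1 on V1 and -1 on V2. *)
pose s : 'rV[R]_n := \row_i (-1) ^+ (v i \notin V1).
have alt i j : G (v i) (v j) -> s 0 i = - s 0 j.
  move=> /bip; rewrite !mxE !V2E; case: (v i \in V1); case: (v j \in V1) => //= _.
    by rewrite expr1 opprK.
have s2 i : s 0 i ^+ 2 = 1 by rewrite mxE sqrr_sign.
have n_gt0 : (0 < n)%N.
  have [w _ _] := bij_v; have [/card_gt0P [x _] _] := connG.
  exact: leq_ltn_trans (ltn_ord (w x)).
have n_neq0 : n%:R != 0 :> R by rewrite pnatr_eq0 -lt0n.
have lam_max : lam ord_max = - r%:R.
  (* The vector s shows that -r is an eigenvalue; it is the last one, as a smaller one would violate
     [lam_ge]. *)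
  have /lamP [i ri] : eigenvalue (adjmx R G v) (- r%:R).
    apply/eigenvalueP; exists s; first exact: alternating_eigenvector.
    apply/eqP => /rowP/(_ (Ordinal n_gt0)) s0.
    by have := s2 (Ordinal n_gt0); rewrite s0 mxE expr0n => /esym/eqP; rewrite oner_eq0.
  have [<- //|imax] := eqVneq i ord_max.
  have : (i < @ord_max d)%N by rewrite ltn_neqAle imax -ltnS ltn_ord.
  by move/lam_decr; rewrite -ri ltNge -subr_ge0 opprK lam_ge.
have lam_gt i : i != ord_max -> 0 < lam i + r%:R.
  by rewrite lt_def lam_ge andbT addr_eq0 -lam_max (inj_eq lamI).
have KP : eigenprojector (adjmx R G v) (- r%:R) (E ord_max) by rewrite -lam_max.
have sumEK : \sum_(i | i != ord_max) E i + E ord_max = 1%:M.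
  by rewrite addrC -sumE [RHS](bigD1 ord_max).
have EE := eigenprojector_opp_degree bij_v bij_f regG connG s2 alt KP.
(* The trace of n^-1 s^T s is 1 because |s|^2 = n. *)
have rk : (m - n + 1)%:R + n%:R = m%:R + \tr (E ord_max).
  rewrite EE mxtraceZ mxtrace_mulC /mxtrace big_ord1 mxE.
  rewrite (eq_bigr (fun=> 1)) => [|i _]; last by rewrite [s^T _ _]mxE -expr2 s2.
  by rewrite sumr_const card_ord mulVf // -natrD addnAC subnK // natrD.
pose S := [set i | v i \in V1].
have initS i j : i \in S -> j \notin S -> (i < j)%N.
  by rewrite !inE => iV1 jV1; apply: ordV; rewrite ?V2E.
(* The entries of s sum to 0, so the two classes have equal size. *)
have S2 : (#|S| + #|S|)%N = n.
  have := alternating_sum bij_v regG (ltnW r_ge2) alt.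
  rewrite (bigID (mem S)) /= (eq_bigr (fun=> 1)) => [|i]; last first.
    by rewrite inE mxE => ->.
  rewrite sumr_const (eq_bigr (fun=> -1)) => [|i]; last by rewrite inE mxE => ->.
  rewrite sumr_const mulNrn => /eqP; rewrite subr_eq0 eqr_nat => /eqP SC.
  by rewrite {2}SC -[RHS](card_ord n) -(cardC (mem S)).
have n2 : n./2 = #|S| by move: S2; lia.
have hn : (n./2 + n./2)%N = n by rewrite n2.
have F0E : FQ_0 R m hn = block_mx (E ord_max) 0 0 0.
  rewrite /FQ_0 scale_block_mx !scaler0 EE; congr (block_mx (_ *: _) _ _ _).
  apply/matrixP => i j; rewrite castmxE /= !mxE big_ord1 !mxE.
  (* As V1 is listed first, the sign of s changes exactly at index n/2, which gives the four blocks
     of [FQ_0]. *)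
  have sE k : (v k \notin V1) = (n./2 <= k)%N.
    by rewrite leqNgt n2 -mem_initial_segment // inE.
  rewrite !sE; case: splitP => i' /= ->; rewrite mxE; case: splitP => j' /= ->;
    rewrite !mxE ?leq_addr ?(leqNgt n./2) ?ltn_ord /= ?expr0 ?expr1; lra.
split=> //; exists hn; rewrite AQE F0E; split.
- move=> a.
  rewrite (eigenvalue_AQ symA BBt lam_gt EP KP sumEK oz Bz rk a E_neq0).
  (* Here q = m - n + 1 is positive and K = E_{-r} is nonzero, so -2 and 0 are both eigenvalues. *)
  rewrite addn1 E_neq0; split=> [[?|[[? _]|[? _]]]|[?|[?|?]]].
  + by left.
  + by right; left.
  + by right; right.
  + by left.
  + by right; left.
  + by right; right.
- exact: (FQ_m2_eigenprojector symA BBt lamI lam_gt EP KP sumEK oz Bz rk).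
- by split=> //; apply: (FQ_0_eigenprojector symA BBt lamI lam_gt EP KP sumEK oz Bz rk).
- by move=> i b; apply: (FQ_eigenprojector symA BBt lamI lam_gt EP KP sumEK oz Bz rk).
- by rewrite scale0r addr0; apply: (AQ_sum symA BBt lam_gt EP KP sumEK oz Bz rk).
Qed.
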